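(* Let $\boldsymbol{S}=\{S_1,S_2\}\subset\mathbb{R}^{2\times2}$ be such that there exists a symmetric positive-definite matrix $P\in\mathbb{R}^{2\times 2}$ with $P-S_k^TPS_k\ge0$ for $k=1,2$. Then $\boldsymbol{S}$ is absolutely stable if and only if $\rho(A)<1$ for all $A\in\{S_1,S_2\}^\ell$, $\ell=1,2$.
   Context: $\rho(A)$ is the spectral radius of $A$; for a symmetric matrix $A$, $A\ge0$ means $x^TAx\ge0$ for all $x$. $\{S_1,S_2\}^\ell$ denotes the set of all products $S_{w_\ell}\cdots S_{w_1}$ with $(w_1,\dots,w_\ell)\in\{1,2\}^\ell$. $\boldsymbol{S}$ is absolutely stable if $\|S_{\sigma_n}\cdots S_{\sigma_1}\|\to0$ as $n\to+\infty$ for every sequence $\sigma=(\sigma_n)_{n\ge1}$ in $\{1,2\}$ (for any, equivalently every, matrix norm). *)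

(* Defs.v *)
From HB Require Import structures.
From mathcomp Require Import all_boot all_order all_algebra.
From mathcomp Require Import all_classical all_reals all_analysis.
From mathcomp Require Import complex.

Set Implicit Arguments.
Unset Strict Implicit.
Unset Printing Implicit Defensive.

Import Order.TTheory GRing.Theory Num.Theory numFieldNormedType.Exports.

Local Open Scope classical_set_scope.
Local Open Scope ring_scope.

Definition quad_form (R : realType) (n : nat) (A : 'M[R]_n) (x : 'cV[R]_n) : R :=
  (x^T *m A *m x) 0 0.

Definition mx_psd (R : realType) (n : nat) (A : 'M[R]_n) : Prop :=
  A^T = A /\ forall x : 'cV[R]_n, 0 <= quad_form A x.

Definition mx_posdef (R : realType) (n : nat) (A : 'M[R]_n) : Prop :=
  A^T = A /\ forall x : 'cV[R]_n, x != 0 -> 0 < quad_form A x.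

(* The eigenvalues are taken over the complex numbers R[i]. For n >= 1 the set
   below is finite and nonempty, so that the supremum is a maximum. *)
Definition spectral_radius (R : realType) (n : nat) (A : 'M[R]_n) : R :=
  sup [set Normc.normc z | z in
        [set z : R[i] | eigenvalue (map_mx (real_complex R) A) z]].

(* mx_word S [:: w1; ...; wl] = S wl *m ... *m S w1 : the first letter of the
   word is the rightmost factor. *)
Definition mx_word (R : realType) (I : Type) (n : nat) (S : I -> 'M[R]_n)
    (w : seq I) : 'M[R]_n :=
  foldl (fun B i => S i *m B) 1%:M w.

Definition mx_products (R : realType) (I : Type) (n : nat) (S : I -> 'M[R]_n)
    (l : nat) : set 'M[R]_n :=
  [set mx_word S w | w in [set: l.-tuple I]].

(* The sequences are indexed from 0, i.e. s k stands for sigma_(k+1). The norm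
   is the largest absolute value of an entry; as all norms on a
   finite-dimensional space are equivalent, this choice is immaterial. *)
Definition absolutely_stable (R : realType) (I : Type) (n : nat)
    (S : I -> 'M[R]_n.+1) : Prop :=
  forall s : nat -> I, `|mx_word S (mkseq s k)| @[k --> \oo] --> (0 : R).

(* Main.v *)
(* In the norm induced by P both matrices are contractions in the wide sense. Since
   rho(S_k) < 1, S_k is not a P-isometry, so the vectors whose P-norm it preserves
   form a subspace L_k of dimension at most 1. If a product S_k S_j S_i preserved
   the norm of some x <> 0, then x, S_i x and S_j S_i x would lie in L_i, L_j and
   L_k. Two of three letters in {1,2} coincide: if consecutive ones do, then S_i or
   S_j has an eigenvector with eigenvalue of modulus 1; otherwise k = i and x is
   such an eigenvector of S_j S_i. Hence every product of length 3 is a strict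
   contraction, and there are finitely many of these. *)
Require Import Defs.
From HB Require Import structures.
From mathcomp Require Import all_boot all_order all_algebra.
From mathcomp Require Import all_classical all_reals all_analysis.
From mathcomp Require Import complex ring lra.

Set Implicit Arguments.
Unset Strict Implicit.
Unset Printing Implicit Defensive.

Import Order.TTheory GRing.Theory Num.Theory numFieldNormedType.Exports.

Local Open Scope classical_set_scope.
Local Open Scope ring_scope.

(** * Eigenvalues and the spectral radius *)

Lemma eigenvalue_seq (F : closedFieldType) (n : nat) (A : 'M[F]_n) :
  exists r : seq F, char_poly A = \prod_(z <- r) ('X - z%:P) /\
    forall z, eigenvalue A z = (z \in r).
Proof.
have [r hr] := closed_field_poly_normal (char_poly A).
move: hr; rewrite (monicP (char_poly_monic A)) scale1r => hr.
by exists r; split=> // z; rewrite eigenvalue_root_char hr root_prod_XsubC.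
Qed.

(** The eigenvalues form a finite list, so the set under [sup] is bounded above; otherwise [sup]
    would take its default value 0. *)
Lemma normc_eigenvalue_le (R : realType) (n : nat) (A : 'M[R]_n) (z : R[i]) :
  eigenvalue (map_mx (real_complex R) A) z ->
  Normc.normc z <= spectral_radius A.
Proof.
move=> hz; have [r [_ hr]] := eigenvalue_seq (map_mx (real_complex R) A).
apply: ub_le_sup; last by exists z.
exists (\big[Num.max/0]_(u <- r) Normc.normc u) => _ [u hu <-].
by apply: le_bigmax_seq; rewrite // -hr.
Qed.

(** Strictness survives the supremum because it is bounded by a maximum over a finite list.
    Positivity of [b] covers an empty spectrum, where [sup] is 0, and the starting value 0 of the
    maximum. *)
Lemma spectral_radius_lt (R : realType) (n : nat) (A : 'M[R]_n) (b : R) :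
  0 < b ->
  (forall z, eigenvalue (map_mx (real_complex R) A) z -> Normc.normc z < b) ->
  spectral_radius A < b.
Proof.
move=> b0 hA; have [r [_ hr]] := eigenvalue_seq (map_mx (real_complex R) A).
rewrite /spectral_radius; set E := [set _ | _ in _].
have [->|/set0P E0] := eqVneq E set0; first by rewrite sup0.
apply: (@le_lt_trans _ _ (\big[Num.max/0]_(u <- r) Normc.normc u)).
  apply: ge_sup => // _ [u hu <-].
  by apply: le_bigmax_seq; rewrite // -hr.
rewrite big_seq; apply: bigmax_lt => // u.
by rewrite -hr; apply: hA.
Qed.

Lemma normc_real (R : rcfType) (x : R) : Normc.normc (x%:C)%C = `|x|.
Proof. by rewrite /= expr0n addr0 sqrtr_sqr. Qed.

(** [eigenvalue] refers to row vectors while [x] is a column; the link is that [A - c%:M] kills [x],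
    hence is not invertible. *)
Lemma spectral_radius_collinear (R : realType) (n : nat) (A : 'M[R]_n)
    (x : 'cV[R]_n) (c : R) :
  x != 0 -> A *m x = c *: x -> `|c| <= spectral_radius A.
Proof.
move=> x0 hx; rewrite -normc_real; apply: normc_eigenvalue_le.
rewrite (eigenvalue_map (real_complex R)) /eigenvalue /eigenspace kermx_eq0.
rewrite row_free_unit; apply: contra_neqN x0 => uA.
by rewrite -(mulKmx uA x) mulmxBl hx mul_scalar_mx subrr mulmx0.
Qed.

Lemma normc_ge0 (R : rcfType) (z : R[i]) : 0 <= Normc.normc z.
Proof. by case: z => a b; exact: sqrtr_ge0. Qed.

Lemma normcX (R : rcfType) (z : R[i]) (m : nat) :
  Normc.normc (z ^+ m) = Normc.normc z ^+ m.
Proof.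
elim: m => [|m IH]; first by rewrite !expr0 Normc.normc1.
by rewrite !exprS Normc.normcM IH.
Qed.

Lemma normc_prod_ge (R : rcfType) (r : seq R[i]) :
  1 <= Normc.normc (\prod_(z <- r) z) -> r != [::] ->
  exists2 z, z \in r & 1 <= Normc.normc z.
Proof.
elim: r => // z r IH; rewrite big_cons Normc.normcM => h _.
have [z1|z1] := leP 1 (Normc.normc z); first by exists z; rewrite ?mem_head.
have hr : 1 <= Normc.normc (\prod_(z <- r) z).
  apply: le_trans h _; rewrite -[leRHS]mul1r ler_wpM2r ?normc_ge0 //.
  exact: ltW.
have r0 : r != [::].
  by apply: contraTneq h => ->; rewrite big_nil Normc.normc1 mulr1 -ltNge.
by have [u ur u1] := IH hr r0; exists u; rewrite // inE ur orbT.
Qed.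

(** The determinant is the product of the complex eigenvalues, so one of them has modulus at least
    1. *)
Lemma spectral_radius_det (R : realType) (n : nat) (A : 'M[R]_n.+1) :
  1 <= `|\det A| -> 1 <= spectral_radius A.
Proof.
move=> hA; set B := map_mx (real_complex R) A.
have [r [hp hr]] := eigenvalue_seq B.
have szr : size r = n.+1.
  by apply: succn_inj; rewrite -(size_prod_XsubC r id) -hp size_char_poly.
(* Evaluate the characteristic polynomial at 0: both sides carry the sign [(-1) ^+ n.+1], which
   cancels. *)
have detB : \prod_(z <- r) z = \det B.
  have := char_poly_det B; rewrite hp -horner_coef0 horner_prod.
  rewrite (_ : \prod_(z <- r) _ =
    (-1) ^+ size r * \prod_(z <- r) z); last first.
    elim: r {hp hr szr} => [|z r IH]; first by rewrite !big_nil mulr1.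
    by rewrite !big_cons IH hornerXsubC exprS; ring.
  by rewrite szr; apply: mulfI; rewrite signr_eq0.
have [||z zr z1] := @normc_prod_ge _ r.
- by rewrite detB det_map_mx normc_real.
- by rewrite -size_eq0 szr.
by apply: le_trans z1 (normc_eigenvalue_le _); rewrite hr.
Qed.

(** For a left eigenvector [v] with [v 0 j != 0], the [j]-th entry of [v *m A ^+ m] has modulus at
    least that of [v 0 j], and at most [|A ^+ m|] times the sum [s] of the moduli of the entries of
    [v]. *)
Lemma power_lower_bound (R : realType) (n : nat) (A : 'M[R]_n.+1) (z : R[i]) :
  eigenvalue (map_mx (real_complex R) A) z -> 1 <= Normc.normc z ->
  exists2 e : R, 0 < e & forall m, e <= `|A ^+ m|.
Proof.
move=> /eigenvalueP[v hv v0] z1.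
have /rV0Pn[j vj0] := v0.
have hm m : v *m map_mx (real_complex R) (A ^+ m) = z ^+ m *: v.
  elim: m => [|m IH]; first by rewrite !expr0 map_mx1 mulmx1 scale1r.
  rewrite exprS -mulmxE map_mxM mulmxA hv -scalemxAl IH scalerA.
  by rewrite -exprS.
have nvj : 0 < Normc.normc (v 0 j).
  rewrite lt_neqAle normc_ge0 andbT eq_sym.
  by apply: contra_neq vj0 => /Normc.eq0_normc.
set s := \sum_i Normc.normc (v 0 i).
have s0 : 0 < s.
  rewrite /s (bigD1 j) //= ltr_pwDl // sumr_ge0 // => i _; exact: normc_ge0.
exists (Normc.normc (v 0 j) / s); first exact: divr_gt0.
move=> m; rewrite ler_pdivrMr //.
apply: (@le_trans _ _ (Normc.normc ((z ^+ m *: v) 0 j))).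
  rewrite mxE Normc.normcM normcX ler_peMl ?normc_ge0 //.
  exact: exprn_ege1.
rewrite -hm mxE mulr_sumr.
elim/big_ind2: _ => [|x1 x2 y1 y2 h1 h2|i _].
- by rewrite Normc.normc0.
- exact: le_trans (le_normcD x2 y2) (lerD h1 h2).
rewrite Normc.normcM mulrC mxE normc_real ler_wpM2r ?normc_ge0 //.
have -> : `|A ^+ m| = mx_norm (A ^+ m) by [].
rewrite mx_normrE.
exact: (le_bigmax _
  (fun ij : 'I_n.+1 * 'I_n.+1 => `|(A ^+ m) ij.1 ij.2|) (i, j)).
Qed.

(** * Periodic sequences and the necessity of the spectral condition *)

Lemma mx_word_cat (R : realType) (I : Type) (n : nat) (S : I -> 'M[R]_n)
    (u w : seq I) : mx_word S (u ++ w) = mx_word S w *m mx_word S u.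
Proof.
elim/last_ind: w => [|w i IH]; first by rewrite cats0 mul1mx.
by rewrite -rcons_cat /mx_word !foldl_rcons -!/(mx_word S _) IH mulmxA.
Qed.

(** Repeating the word of [A] periodically produces all powers of [A] among the partial products; an
    eigenvalue of modulus at least 1 would keep these away from 0. *)
Lemma absolutely_stable_spectral_radius (R : realType) (I : Type) (n : nat)
    (S : I -> 'M[R]_n.+1) (l : nat) (A : 'M[R]_n.+1) :
  absolutely_stable S -> (0 < l)%N -> mx_products S l A ->
  spectral_radius A < 1.
Proof.
move=> hS; case: l => // l _ [w _ <-]; apply: spectral_radius_lt => // z hz.
rewrite ltNge; apply/negP => z1.
have [e e0 he] := power_lower_bound hz z1.
pose s k := tnth w (inord (k %% l.+1)).
have hw m : mkseq s (m * l.+1) = flatten (nseq m (tval w)).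
  elim: m => [|m IH] //=; rewrite -IH mulSn /mkseq iotaD map_cat; congr cat.
    apply: (@eq_from_nth _ (thead w)) => [|k];
      rewrite size_map size_iota ?size_tuple // => kl.
    rewrite (nth_map 0%N) ?size_iota // nth_iota // /s add0n modn_small //.
    by rewrite (tnth_nth (thead w)) inordK.
  rewrite add0n -[X in iota X _]addn0 iotaDl -map_comp; apply: eq_map => k /=.
  by rewrite /s modnDl.
have hp m : mx_word S (mkseq s (m * l.+1)) = mx_word S w ^+ m.
  rewrite hw; elim: m => [|m IH] //=.
  by rewrite mx_word_cat IH exprSr.
have /cvgrPdist_lt/(_ e e0)[N _ hN] := hS s.
(* A multiple of the period that is at least [N]. *)
have := hN (N * l.+1)%N; rewrite /= leq_pmulr // => /(_ isT).
by rewrite sub0r normrN normr_id hp ltNge he.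
Qed.

(** * Quadratic forms in dimension two *)

Lemma forall_ord2 (Q : 'I_2 -> Prop) : Q 0 -> Q 1 -> forall i, Q i.
Proof.
move=> Q0 Q1 [[|[|//]] hi].
- by have -> : Ordinal hi = 0 by exact: val_inj.
- by have -> : Ordinal hi = 1 by exact: val_inj.
Qed.

Lemma sum_ord2 (V : nmodType) (F : 'I_2 -> V) : \sum_i F i = F 0 + F 1.
Proof.
rewrite !big_ord_recl big_ord0 addr0; congr (F _ + F _); exact: val_inj.
Qed.

Lemma quad_form2E (R : realType) (A : 'M[R]_2) (x : 'cV[R]_2) :
  quad_form A x = A 0 0 * x 0 0 ^+ 2 + (A 0 1 + A 1 0) * (x 0 0 * x 1 0) +
    A 1 1 * x 1 0 ^+ 2.
Proof. by rewrite /quad_form !mxE !sum_ord2 !mxE !sum_ord2 !mxE; ring. Qed.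

Definition cV2 (R : realType) (a b : R) : 'cV[R]_2 :=
  \col_i (if i == 0 then a else b).

Lemma cV2_0 (R : realType) (a b : R) : cV2 a b 0 0 = a.
Proof. by rewrite mxE. Qed.

Lemma cV2_1 (R : realType) (a b : R) : cV2 a b 1 0 = b.
Proof. by rewrite mxE. Qed.

Definition cV2E := (cV2_0, cV2_1).

Lemma cV2_neq0 (R : realType) (a b : R) :
  (a != 0) || (b != 0) -> cV2 a b != 0.
Proof.
move=> h; apply: contraTneq h => /matrixP h.
by have := h 0 0; have := h 1 0; rewrite !cV2E !mxE => -> ->; rewrite eqxx.
Qed.

Lemma posdef_sym (R : realType) (N : 'M[R]_2) : mx_posdef N -> N 1 0 = N 0 1.
Proof. by case=> /matrixP/(_ 0 1); rewrite mxE. Qed.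

Lemma posdef_psd (R : realType) (n : nat) (N : 'M[R]_n) :
  mx_posdef N -> mx_psd N.
Proof.
case=> Nt hN; split=> // x; have [->|/hN/ltW//] := eqVneq x 0.
by rewrite /quad_form mulmx0 mxE.
Qed.

Lemma posdef_diag (R : realType) (N : 'M[R]_2) :
  mx_posdef N -> 0 < N 0 0 /\ 0 < N 1 1.
Proof.
case=> _ hN; split.
- have := hN (cV2 1 0); rewrite quad_form2E !cV2E cV2_neq0 ?oner_eq0 //.
  by move=> /(_ isT); lra.
- have := hN (cV2 0 1); rewrite quad_form2E !cV2E cV2_neq0 ?oner_eq0 ?orbT //.
  by move=> /(_ isT); lra.
Qed.

Lemma posdef_ge (R : realType) (N : 'M[R]_2) : mx_posdef N ->
  exists2 d : R, 0 < d &
    forall x : 'cV[R]_2, d * (x 0 0 ^+ 2 + x 1 0 ^+ 2) <= quad_form N x.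
Proof.
move=> hN; have [a0 c0] := posdef_diag hN; have := posdef_sym hN.
(* On this vector the form equals [N 0 0 * \det N], so the determinant is positive. *)
have := hN.2 (cV2 (- N 0 1) (N 0 0)).
rewrite cV2_neq0 ?(gt_eqF a0) ?orbT // quad_form2E !cV2E => /(_ isT).
move: (quad_form2E N) a0 c0 => hq.
set a := N 0 0; set b := N 0 1; set c := N 1 1 => a0 c0 hD e.
move: hD hq; rewrite e -/a -/b -/c => hD hq.
have D0 : 0 < a * c - b ^+ 2.
  by rewrite -(pmulr_rgt0 _ a0); congr (0 < _) : hD; ring.
have ac : 0 < a + c by lra.
(* The smallest eigenvalue is at least det N / tr N. *)
exists ((a * c - b ^+ 2) / (a + c)) => [|x]; first exact: divr_gt0.
rewrite mulrAC ler_pdivrMr // hq -subr_ge0 -/b.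
(* The sum of squares is the squared Euclidean norm of [N *m x]. By Cayley-Hamilton it equals the
   trace times the form minus the determinant times the squared norm of [x]. *)
have := addr_ge0 (sqr_ge0 (a * x 0 0 + b * x 1 0))
  (sqr_ge0 (b * x 0 0 + c * x 1 0)).
by congr (0 <= _); ring.
Qed.

(** The values of the form at [x] and at [x] rotated by a right angle add up to the right-hand side,
    and the latter value is nonnegative. *)
Lemma psd_le (R : realType) (N : 'M[R]_2) (x : 'cV[R]_2) : mx_psd N ->
  quad_form N x <= (N 0 0 + N 1 1) * (x 0 0 ^+ 2 + x 1 0 ^+ 2).
Proof.
case=> _ /(_ (cV2 (x 1 0) (- x 0 0))); rewrite !quad_form2E !cV2E.
by move=> h; rewrite -subr_ge0; congr (0 <= _) : h; ring.
Qed.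

(** With [y = N *m x], the form at [x + t *: y] is [2 * t * b + t ^+ 2 * quad_form N y], where [b]
    is the squared norm of [y]; for small negative [t] this is negative unless [b = 0]. *)
Lemma psd_isotropic (R : realType) (n : nat) (N : 'M[R]_n) (x : 'cV[R]_n) :
  mx_psd N -> quad_form N x = 0 -> N *m x = 0.
Proof.
case=> Nt hN hx; set y := N *m x.
have yt : y^T = x^T *m N by rewrite trmx_mul Nt.
set b := (y^T *m y) 0 0.
have hq (t : R) : 0 <= 2 * t * b + t ^+ 2 * quad_form N y.
  have := hN (x + t *: y); rewrite /quad_form.
  rewrite [(x + t *: y)^T]linearD /= [X in _ + X]linearZ /=.
  rewrite !(mulmxDl, mulmxDr) -!scalemxAl -!scalemxAr.
  have -> : y^T *m N *m x = y^T *m y by rewrite -mulmxA.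
  have -> : x^T *m N *m y = y^T *m y by rewrite yt.
  rewrite /b; move: hx; rewrite /quad_form.
  move: (x^T *m N *m x) (y^T *m y) (y^T *m N *m y) => p q r hp.
  by rewrite !mxE hp; congr (_ <= _); ring.
have b0 : b = 0.
  have q0 := hN y; set q := quad_form N y in hq q0.
  have q1 : 0 < q + 1 by lra.
  (* The minimizer would be [- b / q]; adding 1 keeps the denominator positive when [q = 0]. *)
  have := hq (- b / (q + 1)).
  rewrite (_ : _ + _ = - (b ^+ 2 * ((q + 2) / (q + 1) ^+ 2))); last first.
    by field; rewrite gt_eqF.
  rewrite oppr_ge0 pmulr_lle0; last by rewrite divr_gt0 ?exprn_gt0 //; lra.
  by move=> h; apply/eqP; rewrite -sqrf_eq0 eq_le h sqr_ge0.
apply/colP => i; rewrite [RHS]mxE.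
move: b0; rewrite /b mxE => /psumr_eq0P h.
have /h/(_ i isT) : forall j, true -> 0 <= y^T 0 j * y j 0.
  by move=> j _; rewrite mxE -expr2 sqr_ge0.
by rewrite mxE => /eqP; rewrite mulf_eq0 orbb => /eqP.
Qed.

Lemma kernel2_collinear (R : realType) (N : 'M[R]_2) (x y : 'cV[R]_2) :
  N != 0 -> N *m x = 0 -> N *m y = 0 -> x != 0 -> exists c, y = c *: x.
Proof.
move=> N0 /matrixP hx /matrixP hy x0.
have hD : x 0 0 * y 1 0 = x 1 0 * y 0 0.
  have /existsP[i /existsP[j Nij]] : [exists i, exists j, N i j != 0].
    apply: contraNT N0 => /existsPn h; apply/eqP/matrixP => i j; rewrite mxE.
    by have /existsPn/(_ j) := h i; rewrite negbK => /eqP.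
  (* Row [i] of [N] annihilates [x] and [y]. Eliminating the other column between the two equations
     leaves [N i j] times the determinant of [x] and [y], up to sign. *)
  have := hx i 0; have := hy i 0; rewrite !mxE !sum_ord2 => hyi hxi.
  apply: (mulfI Nij); apply/eqP; rewrite -subr_eq0.
  move: j {Nij}; apply: forall_ord2.
    rewrite (_ : _ - _ = (N i 0 * x 0 0 + N i 1 * x 1 0) * y 1 0 -
      (N i 0 * y 0 0 + N i 1 * y 1 0) * x 1 0); last by ring.
    by rewrite hxi hyi !mul0r subrr.
  rewrite (_ : _ - _ = (N i 0 * y 0 0 + N i 1 * y 1 0) * x 0 0 -
    (N i 0 * x 0 0 + N i 1 * x 1 0) * y 0 0); last by ring.
  by rewrite hxi hyi !mul0r subrr.
have [x00|x00] := eqVneq (x 0 0) 0; last first.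
  exists (y 0 0 / x 0 0); apply/colP; apply: forall_ord2; rewrite mxE.
    by rewrite divfK.
  by apply: (mulfI x00); rewrite hD; field.
have x10 : x 1 0 != 0.
  apply: contra_neq x0 => x10; apply/colP.
  by apply: forall_ord2; rewrite mxE.
exists (y 1 0 / x 1 0); apply/colP; apply: forall_ord2; rewrite mxE.
  by apply: (mulfI x10); rewrite -hD x00; ring.
by rewrite divfK.
Qed.

(** * Contractions in the norm induced by [P] *)

Lemma quad_formB (R : realType) (n : nat) (P M : 'M[R]_n) (x : 'cV[R]_n) :
  quad_form (P - M^T *m P *m M) x = quad_form P x - quad_form P (M *m x).
Proof.
rewrite /quad_form mulmxBr mulmxBl trmx_mul !mulmxA.
by rewrite [LHS]mxE [X in _ + X]mxE.
Qed.

Lemma quad_formZ (R : realType) (n : nat) (P : 'M[R]_n) (c : R)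
    (x : 'cV[R]_n) : quad_form P (c *: x) = c ^+ 2 * quad_form P x.
Proof.
by rewrite /quad_form [(c *: x)^T]linearZ /= -scalemxAr -!scalemxAl scalerA mxE.
Qed.

Lemma isometric_line_spectral_radius (R : realType) (n : nat)
    (P M : 'M[R]_n) (x : 'cV[R]_n) (c : R) :
  mx_posdef P -> x != 0 -> M *m x = c *: x ->
  quad_form P (M *m x) = quad_form P x -> 1 <= spectral_radius M.
Proof.
move=> [_ hP] x0 hx; rewrite hx quad_formZ => hc.
apply: le_trans (spectral_radius_collinear x0 hx).
rewrite -ler_sqr ?nnegrE ?normr_ge0 // real_normK ?num_real //.
rewrite expr1n -(ler_pM2r (hP x x0)) hc mul1r //.
Qed.

(** Vectors whose norm is preserved are isotropic for the positive semidefinite defect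
    [P - M^T *m P *m M], hence lie in its kernel. The defect is nonzero: otherwise [|\det M| = 1],
    against the bound on the spectral radius. *)
Lemma isometric_vectors_collinear (R : realType) (P M : 'M[R]_2)
    (x y : 'cV[R]_2) :
  mx_posdef P -> mx_psd (P - M^T *m P *m M) -> spectral_radius M < 1 ->
  x != 0 -> quad_form P (M *m x) = quad_form P x ->
  quad_form P (M *m y) = quad_form P y -> exists c, y = c *: x.
Proof.
move=> hP hM rM x0 hx hy.
apply: (@kernel2_collinear _ (P - M^T *m P *m M)) => //.
- apply: contraTneq rM => /subr0_eq eP; rewrite -leNgt.
  apply: spectral_radius_det.
  have detP : \det P != 0.
    rewrite -unitfE -unitmxE -row_free_unit -kermx_eq0.
    apply/negPn/negP => /rowV0Pn[v /sub_kermxP vP v0].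
    have := hP.2 v^T; rewrite /quad_form trmxK vP mul0mx mxE ltxx.
    suff -> : v^T != 0 by move/(_ isT).
    by apply: contra_neq v0 => /(congr1 trmx); rewrite trmxK trmx0.
  have : `|\det M| ^+ 2 = 1.
    rewrite real_normK ?num_real //; apply: (mulfI detP); rewrite mulr1.
    by rewrite {2}eP !det_mulmx det_tr; ring.
  by move/eqP; rewrite -(expr1n _ 2) eqrXn2 ?normr_ge0 // => /eqP ->.
- by apply: psd_isotropic; rewrite ?quad_formB ?hx ?subrr.
- by apply: psd_isotropic; rewrite ?quad_formB ?hy ?subrr.
Qed.

(** No compactness is involved: the defect is at least [d] times the squared Euclidean norm, and the
    form of [P] is at most its trace [t] times that norm, whence the ratio [1 - d / t]. *)
Lemma strict_contraction_ratio (R : realType) (P W : 'M[R]_2) :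
  mx_posdef P ->
  (forall x, x != 0 -> quad_form P (W *m x) < quad_form P x) ->
  exists2 c : R, c < 1 &
    forall x, quad_form P (W *m x) <= c * quad_form P x.
Proof.
move=> hP hW; have [p0 p1] := posdef_diag hP.
have /posdef_ge[d d0 hd] : mx_posdef (P - W^T *m P *m W).
  split; last by move=> x x0; rewrite quad_formB subr_gt0 hW.
  by rewrite linearB /= !trmx_mul trmxK hP.1 mulmxA.
set t := P 0 0 + P 1 1; have t0 : 0 < t by rewrite addr_gt0.
exists (1 - d / t) => [|x]; first by rewrite ltrBlDr ltrDl divr_gt0.
have := hd x; rewrite quad_formB; have := psd_le x (posdef_psd hP).
rewrite -/t => h1 h2.
suff : d / t * quad_form P x <= d * (x 0 0 ^+ 2 + x 1 0 ^+ 2) by lra.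
by rewrite mulrAC ler_pdivrMr // -mulrA ler_pM2l // mulrC.
Qed.

Lemma word3_contraction (R : realType) (P : 'M[R]_2) (S : 'I_2 -> 'M[R]_2) :
  mx_posdef P -> (forall k, mx_psd (P - (S k)^T *m P *m S k)) ->
  (forall i, spectral_radius (S i) < 1) ->
  (forall i j, spectral_radius (S j *m S i) < 1) ->
  forall (i j k : 'I_2) (x : 'cV[R]_2), x != 0 ->
    quad_form P (S k *m (S j *m (S i *m x))) < quad_form P x.
Proof.
move=> hP hS r1 r2 i j k x x0.
have le k' y : quad_form P (S k' *m y) <= quad_form P y.
  by have := (hS k').2 y; rewrite quad_formB subr_ge0.
set y := S i *m x; set z := S j *m y.
rewrite lt_neqAle; apply/andP; split; last first.
  by apply: le_trans (le _ _) _; apply: le_trans (le _ _) _; exact: le.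
(* Equality at the two ends of a chain of three inequalities forces equality in each. *)
apply/eqP => hk; have [[lx ly] lz] := (le i x, le j y, le k z).
rewrite -/y -/z in lx ly lz.
have hx : quad_form P y = quad_form P x by lra.
have hy : quad_form P z = quad_form P y by lra.
have hz : quad_form P (S k *m z) = quad_form P z by lra.
(* Both [u] and [S l *m u] keep their norm under [S l], so they are collinear and [u] is an
   eigenvector with eigenvalue of modulus 1. *)
have no_repeat l (u : 'cV[R]_2) : u != 0 ->
    quad_form P (S l *m u) = quad_form P u ->
    quad_form P (S l *m (S l *m u)) = quad_form P (S l *m u) -> False.
  move=> u0 h1 h2.
  have [c hc] := isometric_vectors_collinear hP (hS l) (r1 l) u0 h1 h2.
  have := isometric_line_spectral_radius hP u0 hc h1.
  by rewrite leNgt r1.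
have y0 : y != 0.
  apply: contraTneq (hP.2 x x0) => y0.
  by rewrite -hx y0 /quad_form mulmx0 mxE ltxx.
have [ij|ij] := eqVneq i j; first by move: hy; rewrite /z -ij; exact: no_repeat.
have [jk|jk] := eqVneq j k; first by move: hz; rewrite -jk; exact: no_repeat.
have ki : k = i.
  by move: i j k ij jk {y z hk lx ly lz hx hy hz y0}; do 3 apply: forall_ord2.
rewrite ki in hz.
(* Here [x] and [z] both keep their norm under [S i], so [z = S j *m S i *m x] is a multiple of
   [x]. *)
have [c hc] := isometric_vectors_collinear hP (hS i) (r1 i) x0 hx hz.
have : 1 <= spectral_radius (S j *m S i).
  apply: (isometric_line_spectral_radius hP x0 (c := c)); rewrite -mulmxA //.
  by rewrite -/y -/z hy hx.
by rewrite leNgt r2.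
Qed.

(** * Convergence to zero and the sufficiency of the spectral condition *)

Lemma cvg0_of_contraction (R : realType) (u : R^nat) (c : R) (p : nat) :
  c < 1 -> (forall n, 0 <= u n) -> (forall n, u n.+1 <= u n) ->
  (forall n, u (n + p)%N <= c * u n) -> u @ \oo --> (0 : R).
Proof.
move=> c1 u0 hu hc.
have /nonincreasing_is_cvgn : {homo u : n m / (n <= m)%N >-> m <= n}.
  exact/nonincreasing_seqP.
have lb : has_lbound (range u) by exists 0 => _ [n _ <-].
move=> /(_ lb); set L := lim _; rewrite -/L => cu.
have L0 : 0 <= L by apply: limr_ge => //; apply: nearW.
suff -> : 0 = L by [].
(* The shifted sequence has the same limit [L]; as [c < 1] and [L] is nonnegative, this inequality
   forces [L = 0]. *)
have hL : L <= c * L.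
  have cp : (fun n => u (n + p)%N) @ \oo --> L by rewrite cvg_shiftn.
  have cc : (fun n => c * u n) @ \oo --> c * L.
    by apply: cvgM; [exact: cvg_cst|exact: cu].
  by apply: ler_cvg_to cp cc _; exact: nearW.
by apply/eqP; rewrite eq_le L0 /=; nra.
Qed.
Lemma spectral_radius_stable (R : realType) (P : 'M[R]_2)
    (S : 'I_2 -> 'M[R]_2) :
  mx_posdef P -> (forall k, mx_psd (P - (S k)^T *m P *m S k)) ->
  (forall i, spectral_radius (S i) < 1) ->
  (forall i j, spectral_radius (S j *m S i) < 1) ->
  absolutely_stable S.
Proof.
move=> hP hS r1 r2 s; set W := fun k => mx_word S (mkseq s k).
have WS k : W k.+1 = S (s k) *m W k by rewrite /W mkseqS /mx_word foldl_rcons.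
have [c c1 hc] : exists2 c : R, c < 1 & forall i j k x,
    quad_form P (S k *m (S j *m (S i *m x))) <= c * quad_form P x.
  (* One ratio for each of the eight words of length 3; their maximum, started at 0, is still below
     1. *)
  have /choice[f hf] : forall w : 'I_2 * 'I_2 * 'I_2, exists c : R, c < 1 /\
      forall x, quad_form P (S w.2 *m S w.1.2 *m S w.1.1 *m x) <=
        c * quad_form P x.
    move=> [[i j] k].
    have [|c c1 hc] := @strict_contraction_ratio _ P (S k *m S j *m S i) hP.
      by move=> x x0; rewrite -!mulmxA; exact: word3_contraction.
    by exists c.
  exists (\big[Num.max/0]_w f w).
    by apply: bigmax_lt => // w _; case: (hf w).
  move=> i j k x; have [_ /(_ x)] := hf (i, j, k).
  rewrite -!mulmxA => /le_trans; apply.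
  apply: ler_wpM2r; first exact: (posdef_psd hP).2.
  exact: (le_bigmax _ f).
have hu (x : 'cV[R]_2) : (fun k => quad_form P (W k *m x)) @ \oo --> (0 : R).
  apply: (@cvg0_of_contraction _ _ c 3) => // k.
  - exact: (posdef_psd hP).2.
  - have := (hS (s k)).2 (W k *m x).
    by rewrite quad_formB subr_ge0 WS mulmxA.
  - by rewrite addn3 !WS -!mulmxA.
have [d d0 hd] := posdef_ge hP.
apply/cvgrPdist_lt => e e0.
(* Finitely many basis vectors suffice. The threshold is chosen so that [posdef_ge] bounds the
   squared norm of every column of [W k] by [e ^+ 2], and hence every entry by [e]. *)
have : \forall k \near \oo, forall j : 'I_2,
    quad_form P (W k *m delta_mx j 0) < d * e ^+ 2.
  apply: filter_forall => j.
  have de : 0 < d * e ^+ 2 by rewrite mulr_gt0 ?exprn_gt0.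
  have /cvgrPdist_lt/(_ _ de) := hu (delta_mx j 0).
  apply: filterS => k; rewrite sub0r normrN; apply: le_lt_trans.
  exact: ler_norm.
apply: filterS => k hk; rewrite sub0r normrN normr_id.
have -> : `|W k| = mx_norm (W k) by [].
rewrite mx_normrE; apply: bigmax_lt => // -[i j] _ /=.
have := le_lt_trans (hd _) (hk j); rewrite ltr_pM2l // -colE !mxE => hij.
rewrite -ltr_sqr ?nnegrE ?normr_ge0 ?(ltW e0) // real_normK ?num_real //.
apply: le_lt_trans hij; move: i; apply: forall_ord2.
- by rewrite lerDl sqr_ge0.
- by rewrite lerDr sqr_ge0.
Qed.

Theorem theoremC (R : realType) (S : 'I_2 -> 'M[R]_2)
    (hP : exists P : 'M[R]_2,
        mx_posdef P /\ forall k : 'I_2, mx_psd (P - (S k)^T *m P *m S k)) :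
  absolutely_stable S <->
  (forall l : nat, l = 1%N \/ l = 2%N ->
     forall A : 'M[R]_2, mx_products S l A -> spectral_radius A < 1).
Proof.
have [P [P0 PS]] := hP; split=> [hS l hl A|hr].
  by apply: absolutely_stable_spectral_radius => //; case: hl => ->.
apply: (spectral_radius_stable P0 PS) => [i|i j].
- apply: (hr 1%N); first by left.
  by exists [tuple i] => //; rewrite /mx_word /= mulmx1.
- apply: (hr 2%N); first by right.
  by exists [tuple i; j] => //; rewrite /mx_word /= mulmx1.
Qed.
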